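(* Let $f:\mathbb{N}\to\mathbb{C}$ be a completely multiplicative function with $|f(n)|=1$ for all $n\in\mathbb{N}$. Then for all $a,k\in\mathbb{N}$, $$\liminf_{n\to\infty}|f(an+k)-f(an)|=0.$$
   Context: $\mathbb{N}=\{1,2,\dots\}$. A function $f:\mathbb{N}\to\mathbb{C}$ is completely multiplicative if $f(mn)=f(m)f(n)$ for all $m,n\in\mathbb{N}$. *)

(* Defs.v *)
From Stdlib Require Import Reals.
From Coquelicot Require Import Coquelicot.

(* A function on the positive integers is represented by a function on nat
   whose value at 0 is unconstrained and irrelevant. *)
Definition completely_multiplicative (f : nat -> C) : Prop :=
  forall m n : nat, (1 <= m)%nat -> (1 <= n)%nat ->
    f (m * n)%nat = Cmult (f m) (f n).

(* Main.v *)
Require Import Defs.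
From Stdlib Require Import Reals.
From Coquelicot Require Import Coquelicot.
From Stdlib Require Import Arith List Lia Lra Classical.

(** The values of [f] lie on the unit circle, so among sufficiently many
    integers [m 0 < ... < m (r - 1)] two, say [m i < m j], have nearly equal
    images.  By complete multiplicativity the distance between [f (m i)] and
    [f (m j)] depends only on the ratio [m j / m i], so it suffices to find
    arbitrarily long finite families all of whose ratios [m j / m i] have the
    form [(a * n + k) / (a * n)] with [n] large.  For [n = k * q] this ratio is
    [(a * q + 1) / (a * q)]; hence the requirement is that the difference
    [d = m j - m i] satisfies [m i = a * q * d] with [q] large.

    Such families exist ([exists_family_gaps_divide]).  Given one, let [L] be a
    large multiple of [a] times every member and every difference.  Then
    [L, L + m 0, ..., L + m (r - 1)] is a longer one: translating by [L]
    preserves the old differences, which still divide suitably, and the new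
    differences [m i] divide [L].  The lower limit is therefore at most 0, and
    it is nonnegative because the sequence consists of moduli. *)

(** * Families of integers whose differences divide their members *)

Lemma divide_fact_of_le (d M : nat) :
  (1 <= d)%nat -> (d <= M)%nat -> exists e, fact M = (e * d)%nat.
Proof.
intros hd; induction M as [|M IH]; intros hM; [lia|].
destruct (Nat.eq_dec d (S M)) as [->|ne].
- exists (fact M). change (fact (S M)) with (S M * fact M)%nat. ring.
- destruct IH as [e he]; [lia|].
  exists (S M * e)%nat. change (fact (S M)) with (S M * fact M)%nat.
  rewrite he. ring.
Qed.

(** The bound [M] is what makes the induction run: every member and every
    difference is at most [M], so [fact M] is a common multiple of them all. *)
Lemma exists_family_gaps_divide (a N r : nat) : (1 <= a)%nat ->
  exists (m : nat -> nat) (M : nat),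
    (forall i, (i < r)%nat -> (1 <= m i <= M)%nat) /\
    (forall i j, (i < j)%nat -> (j < r)%nat ->
      exists q d, (N <= q)%nat /\ (1 <= d)%nat /\
        m i = (a * q * d)%nat /\ m j = (m i + d)%nat).
Proof.
intros ha; induction r as [|r [m [M [hm hgap]]]].
- exists (fun _ => 1%nat), 1%nat. split; intros; lia.
- (* The factor [S N] makes the quotients of the new gaps exceed [N]. *)
  set (L := (a * (S N * fact M))%nat).
  assert (hF : (1 <= fact M)%nat) by apply lt_O_fact.
  assert (hL : (1 <= L)%nat) by (unfold L; nia).
  exists (fun i => match i with O => L | S i' => L + m i' end)%nat, (L + M)%nat.
  split.
  + intros [|i] hi; [lia|]. specialize (hm i). lia.
  + intros [|i] [|j] hij hj; try lia.
    * destruct (hm j) as [h1 h2]; [lia|].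
      destruct (divide_fact_of_le (m j) M h1 h2) as [e he].
      exists (S N * e)%nat, (m j).
      assert (1 <= e)%nat by nia.
      repeat split; [nia|lia|].
      unfold L; rewrite he; ring.
    * destruct (hgap i j) as [q [d [hq [hd [hi hjd]]]]]; [lia|lia|].
      destruct (hm j) as [h1 h2]; [lia|].
      destruct (divide_fact_of_le d M hd) as [e he]; [lia|].
      exists (S N * e + q)%nat, d.
      repeat split; [lia|lia| |lia].
      rewrite hi; unfold L; rewrite he; ring.
Qed.

(** * Pigeonhole in the unit disc *)

Lemma pigeonhole_nat (K : nat) (c : nat -> nat) :
  (forall i, (c i < K)%nat) ->
  exists i j, (i < j)%nat /\ (j < S K)%nat /\ c i = c j.
Proof.
intros hc; apply NNPP; intros hno.
assert (hnd : NoDup (map c (seq 0 (S K)))).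
{ apply NoDup_map_NoDup_ForallPairs; [|apply seq_NoDup].
  intros x y hx hy hxy. apply in_seq in hx; apply in_seq in hy.
  destruct (Nat.lt_trichotomy x y) as [h|[h|h]]; [|exact h|];
    exfalso; apply hno; [exists x, y|exists y, x]; repeat split;
    (lia || congruence). }
apply NoDup_incl_length with (l' := seq 0 K) in hnd.
- rewrite length_map, !length_seq in hnd; lia.
- intros y hy. apply in_map_iff in hy. destruct hy as [x [<- _]].
  apply in_seq; specialize (hc x); lia.
Qed.

(** Cutting [-1, 1] into cells of length [1 / K]: a cell index records a point
    up to an error smaller than [1 / K]. *)
Lemma exists_cell (K : nat) (x : R) : (-1 <= x <= 1)%R ->
  {p : nat | (p < 2 * K + 1)%nat /\ (INR p <= INR K * (x + 1) < INR p + 1)%R}.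
Proof.
intros hx. assert (hK := pos_INR K).
destruct (nfloor_ex (INR K * (x + 1))) as [p hp]; [nra|].
exists p; split; [|exact hp].
apply INR_lt. rewrite plus_INR, mult_INR. simpl. nra.
Qed.

Lemma Cmod_le_Rabs_add (z : C) : (Cmod z <= Rabs (fst z) + Rabs (snd z))%R.
Proof.
unfold Cmod. assert (h1 := Rabs_pos (fst z)). assert (h2 := Rabs_pos (snd z)).
rewrite <- (sqrt_pow2 (Rabs (fst z) + Rabs (snd z))) by lra.
apply sqrt_le_1_alt.
rewrite <- (pow2_abs (fst z)), <- (pow2_abs (snd z)). nra.
Qed.

Lemma exists_close_pair (eps : posreal) :
  exists r : nat, forall z : nat -> C, (forall i, (Cmod (z i) <= 1)%R) ->
    exists i j, (i < j)%nat /\ (j < r)%nat /\ (Cmod (Cminus (z j) (z i)) < eps)%R.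
Proof.
(* Each coordinate contributes an error below [1 / K], so [K > 2 / eps] suffices. *)
destruct (nfloor_ex (2 / eps)) as [K0 hK0].
{ apply Rlt_le, Rdiv_lt_0_compat; [lra|apply cond_pos]. }
set (K := S K0).
assert (hK : (2 < INR K * eps)%R).
{ unfold K; rewrite S_INR. assert (he := cond_pos eps).
  apply (Rmult_lt_reg_r (/ eps)); [now apply Rinv_0_lt_compat|].
  rewrite Rmult_assoc, Rinv_r by lra. unfold Rdiv in hK0; lra. }
set (B := (2 * K + 1)%nat).
exists (S (B * B)). intros z hz.
assert (hcode : forall i, {c : nat | (c < B * B)%nat /\ exists p q : nat,
  (q < B)%nat /\ c = (B * p + q)%nat /\
  (INR p <= INR K * (fst (z i) + 1) < INR p + 1)%R /\
  (INR q <= INR K * (snd (z i) + 1) < INR q + 1)%R}).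
{ intros i. assert (h := Rle_trans _ _ _ (Rmax_Cmod (z i)) (hz i)).
  assert (h1 := Rle_trans _ _ _ (Rmax_l _ _) h).
  assert (h2 := Rle_trans _ _ _ (Rmax_r _ _) h).
  apply Rabs_le_between in h1; apply Rabs_le_between in h2.
  destruct (exists_cell K _ h1) as [p [hp hp']].
  destruct (exists_cell K _ h2) as [q [hq hq']].
  exists (B * p + q)%nat. fold B in hp, hq. split; [nia|].
  exists p, q; auto. }
set (c := fun i => proj1_sig (hcode i)).
assert (hc := fun i => proj2_sig (hcode i)).
destruct (pigeonhole_nat (B * B) c) as [i [j [hij [hj heq]]]].
{ intros i; apply hc. }
exists i, j; split; [exact hij|split; [exact hj|]].
destruct (hc i) as [_ [p [q [hq [e [hp1 hq1]]]]]].
destruct (hc j) as [_ [p' [q' [hq' [e' [hp2 hq2]]]]]].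
destruct (Nat.div_mod_unique B p p' q q' hq hq') as [<- <-].
{ unfold c in heq; congruence. }
assert (hKpos : (0 < INR K)%R) by (apply lt_0_INR; unfold K; lia).
apply (Rmult_lt_reg_l (INR K)); [exact hKpos|].
apply Rle_lt_trans with (2 := hK).
apply Rle_trans with
  (INR K * (Rabs (fst (z j) - fst (z i)) + Rabs (snd (z j) - snd (z i))))%R.
{ apply Rmult_le_compat_l; [lra|]. apply (Cmod_le_Rabs_add (Cminus (z j) (z i))). }
rewrite Rmult_plus_distr_l.
rewrite <- (Rabs_pos_eq (INR K)) by lra. rewrite <- !Rabs_mult.
assert (Rabs (INR K * (fst (z j) - fst (z i))) <= 1)%R
  by (apply Rabs_le; lra).
assert (Rabs (INR K * (snd (z j) - snd (z i))) <= 1)%R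
  by (apply Rabs_le; lra).
lra.
Qed.

(** * Transfer along equal ratios *)

(** With [A = a * n], both pairs [(A + k, A)] and [(y, x)] have the same ratio:
    multiplying the first by [d] and the second by [k] gives the same pair. *)
Lemma Cmod_sub_eq_of_ratio (f : nat -> C)
  (hmul : completely_multiplicative f)
  (hmod : forall n : nat, (1 <= n)%nat -> Cmod (f n) = 1%R)
  (A k x y d : nat) :
  (1 <= A)%nat -> (1 <= k)%nat -> (1 <= x)%nat -> (1 <= d)%nat ->
  (A * d = k * x)%nat -> y = (x + d)%nat ->
  Cmod (Cminus (f (A + k)%nat) (f A)) = Cmod (Cminus (f y) (f x)).
Proof.
intros hA hk hx hd hAd ->.
assert (e1 : Cmult (f d) (f A) = Cmult (f k) (f x)).
{ rewrite <- !hmul by lia. f_equal; lia. }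
assert (e2 : Cmult (f d) (f (A + k)%nat) = Cmult (f k) (f (x + d)%nat)).
{ rewrite <- !hmul by lia. f_equal; lia. }
rewrite <- (Rmult_1_l (Cmod (Cminus (f (A + k)%nat) _))), <- (hmod d hd).
rewrite <- (Rmult_1_l (Cmod (Cminus (f (x + d)%nat) _))), <- (hmod k hk).
rewrite <- !Cmod_mult. f_equal.
transitivity (Cminus (Cmult (f d) (f (A + k)%nat)) (Cmult (f d) (f A))); [ring|].
rewrite e1, e2. ring.
Qed.

Theorem corollary1p7 (f : nat -> C)
  (hmul : completely_multiplicative f)
  (hmod : forall n : nat, (1 <= n)%nat -> Cmod (f n) = 1%R)
  (a k : nat) (ha : (1 <= a)%nat) (hk : (1 <= k)%nat) :
  LimInf_seq (fun n : nat => Cmod (Cminus (f (a * n + k)%nat) (f (a * n)%nat)))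
  = Finite 0%R.
Proof.
apply is_LimInf_seq_unique. intros eps; split.
- intros N.
  destruct (exists_close_pair eps) as [r hr].
  destruct (exists_family_gaps_divide a N r ha) as [m [M [hm hgap]]].
  (* [m i] is positive only for [i < r]; [Nat.max 1] keeps every argument of
     [f] in the range where [f] has modulus one. *)
  destruct (hr (fun i => f (Nat.max 1 (m i)))) as [i [j [hij [hj hlt]]]].
  { intros i. rewrite hmod by lia. lra. }
  destruct (hm i) as [hi _]; [lia|]. destruct (hm j) as [hj1 _]; [lia|].
  cbv beta in hlt. rewrite !Nat.max_r in hlt by lia.
  destruct (hgap i j hij hj) as [q [d [hq [hd [ei ej]]]]].
  assert (hq1 : (1 <= q)%nat) by nia.
  exists (k * q)%nat. split; [nia|].
  rewrite (Cmod_sub_eq_of_ratio f hmul hmod (a * (k * q)) k (m i) (m j) d);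
    [lra|nia|lia|lia|lia|rewrite ei; ring|lia].
- exists 0%nat. intros n _.
  assert (h := Cmod_ge_0 (Cminus (f (a * n + k)%nat) (f (a * n)%nat))).
  assert (he := cond_pos eps). lra.
Qed.
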